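(* Let $G_0, G_1, \ldots, G_{n-1}$ be connected graphs and let $k_0, k_1, \ldots, k_{n-1}$ be integers with $k_i \ge c(G_i)$ for each $i$. Let $K = k_0 + k_1 + \cdots + k_{n-1}$. Then $$\mathrm{capt}_K(G_0 \square G_1 \square \cdots \square G_{n-1}) \le \left( \sum_{i=0}^{n-1} \mathrm{rad}(G_i) \right)\lceil \log_2 n\rceil + \sum_{i=0}^{n-1} (\mathrm{capt}_{k_i}(G_i) - 1) + 1.$$
   Context: Cops and Robbers is played on a finite reflexive graph (every vertex carries a loop, so a player may pass). The cops first choose starting vertices (turn 0), then the robber chooses a starting vertex; afterwards players alternate, the cops moving first: each cop moves to a neighbouring vertex or stays, then the robber moves to a neighbouring vertex or stays. A round is a cop move together with the subsequent robber move. The cops win when some cop occupies the same vertex as the robber. The cop number $c(G)$ is the minimum number of cops having a winning strategy. For $k \ge c(G)$, $\mathrm{capt}_k(G)$ is the minimum, over strategies of $k$ cops, of the number of rounds (not counting round 0) needed to capture the robber, assuming the robber plays to delay capture as long as possible. The Cartesian product $G \square H$ has vertex set $V(G)\times V(H)$, with $(u,v)$ adjacent to $(u',v')$ iff either $u=u'$ and $vv' \in E(H)$, or $v=v'$ and $uu'\in E(G)$. The radius $\mathrm{rad}(G)$ is the minimum over vertices $u$ of the maximum distance from $u$ to another vertex.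
   Formalization: The bound fails with one-vertex factors (two copies of K_1 give 0 ≤ -1), so it is proved as stated when every G_i has at least two vertices, and for arbitrary connected G_i with capt_{k_i}(G_i) - 1 replaced by max(capt_{k_i}(G_i) - 1, 0). *)

(* Defs.v *)
From HB Require Import structures.
From mathcomp Require Import all_boot all_order.
From mathcomp Require Import boolp classical_sets.

Set Implicit Arguments.
Unset Strict Implicit.
Unset Printing Implicit Defensive.

Local Open Scope nat_scope.

(* The value is meaningful only when some n satisfies P (it is 0 otherwise). *)
Definition least (P : nat -> Prop) : nat :=
  xget 0 [set n | P n /\ forall m, P m -> n <= m]%classic.

Lemma leastP (P : nat -> Prop) :
  (exists n, P n) -> P (least P) /\ forall m, P m -> least P <= m.
Proof.
move=> exP; have exb : exists n, `[< P n >].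
  by case: exP => n Pn; exists n; apply/asboolP.
have [n /asboolP Pn min_n] := ex_minnP exb.
have nP : [set n | P n /\ forall m, P m -> n <= m]%classic n.
  by split=> // m Pm; apply: min_n; apply/asboolP.
exact: (xgetI 0 nP).
Qed.

Record graph := Graph {
  vertex :> finType;
  adj : rel vertex;
  adj_sym : symmetric adj;
  adj_refl : reflexive adj
}.

Definition connected (G : graph) : Prop :=
  0 < #|G| /\ forall u v : G, connect (@adj G) u v.

Definition dist (G : graph) (u v : G) : nat :=
  least (fun d => exists p : seq G,
    [/\ path (@adj G) u p, last u p = v & size p = d]).

Definition eccentricity (G : graph) (u : G) : nat := \max_(v : G) dist u v.

Definition radius (G : graph) : nat :=
  least (fun d => exists u : G, eccentricity u = d).

Section CartesianProduct.
Variables (n : nat) (G : 'I_n -> graph).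

(* The disjunct x == y is redundant for n > 0, the factors being reflexive; it
   provides the loop of the one-vertex product when n = 0. *)
Definition prod_adj : rel {dffun forall i : 'I_n, G i} := fun x y =>
  (x == y) || [exists i, adj (x i) (y i) && [forall j, (j != i) ==> (x j == y j)]].

Lemma prod_adj_sym : symmetric prod_adj.
Proof.
move=> x y; rewrite /prod_adj eq_sym; congr (_ || _).
apply: eq_existsb => i; rewrite adj_sym; apply: andb_id2l => _.
by apply: eq_forallb => j; rewrite [x j == _]eq_sym.
Qed.

Lemma prod_adj_refl : reflexive prod_adj.
Proof. by move=> x; rewrite /prod_adj eqxx. Qed.

Definition cart_prod : graph := Graph prod_adj_sym prod_adj_refl.

End CartesianProduct.

Section CopsAndRobbers.
Variables (G : graph) (k : nat).

(* r t is the robber's vertex at the end of round t; r 0 is the initial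
   placement. *)
Definition robber_walk (r : nat -> G) : Prop := forall t, adj (r t) (r t.+1).

(* s [:: r 0; ...; r t.-1] is the position of the k cops in round t; in
   particular s [::] is their initial placement, chosen before the robber's.
   As the cops are deterministic, facing every robber walk fixed in advance is
   the same as facing every adaptive robber. *)
Definition strategy := seq G -> {ffun 'I_k -> G}.

Definition cops_at (s : strategy) (r : nat -> G) (t : nat) : {ffun 'I_k -> G} :=
  s (mkseq r t).

Definition legal (s : strategy) : Prop :=
  forall r, robber_walk r ->
  forall t (j : 'I_k), adj (cops_at s r t j) (cops_at s r t.+1 j).

(* In round t > 0 a cop can meet the robber after the cops' move, when the robber
   is still on r t.-1, or after the robber's move to r t. *)
Definition captured_in_round (s : strategy) (r : nat -> G) (t : nat) : Prop :=
  exists j : 'I_k,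
    (0 < t /\ cops_at s r t j = r t.-1) \/ cops_at s r t j = r t.

Definition winning (s : strategy) : Prop :=
  legal s /\
  forall r, robber_walk r -> exists t, captured_in_round s r t.

Definition winning_within (T : nat) (s : strategy) : Prop :=
  legal s /\
  forall r, robber_walk r -> exists2 t, t <= T & captured_in_round s r t.

End CopsAndRobbers.

Definition cop_number (G : graph) : nat :=
  least (fun k => exists s : strategy G k, winning s).

(* Meaningful when cop_number G <= k. *)
Definition capt (k : nat) (G : graph) : nat :=
  least (fun T => exists s : strategy G k, winning_within T s).

(* Main.v *)
(* A cop can always follow the robber's moves in a factor without increasing
   their distance there, and shortens it whenever the robber moves elsewhere or
   passes. In G [] H let a team A, starting in the centre of H, follow the moves
   in H and use the moves in G and the passes, first to bring all its cops onto
   the robber's H-coordinate (at most rad H of them), then to play a winning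
   strategy of G (at most capt G of them); let B do the same with G and H
   exchanged. While no cop has won, at most rad H + capt G - 1 moves are useful
   to A and at most rad G + capt H - 1 to B, and every robber move is useful to
   one of them, so capt - 1 is subadditive up to rad G + rad H. Halving the set
   of factors repeatedly pays each radius at most up_log 2 n times. *)
Require Import Defs.
From HB Require Import structures.
From mathcomp Require Import all_boot all_order all_algebra.
From mathcomp Require Import boolp.
From mathcomp Require Import zify.
Import Order.TTheory GRing.Theory Num.Theory.

Set Implicit Arguments.
Unset Strict Implicit.
Unset Printing Implicit Defensive.

(** * The game as a recursion on positions *)

Section PositionalGame.
Variables (X : Type) (mv eqv : X -> X -> Prop).

(** Capture is up to [eqv], so that it can mean agreement on some of the factors of a product. *)
Definition caught (J : Type) (c : J -> X) (x : X) : Prop :=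
  exists j, eqv (c j) x.

(* The cops are about to move and need at most T rounds. *)
Fixpoint cops_win (J : Type) (T : nat) (c : J -> X) (x : X) : Prop :=
  if T is T'.+1 then
    caught c x \/ exists2 c' : J -> X, (forall j, mv (c j) (c' j)) &
      caught c' x \/ forall x', mv x x' -> cops_win T' c' x'
  else caught c x.

Lemma caught_cops_win J T (c : J -> X) x : caught c x -> cops_win T c x.
Proof. by case: T => [|T] //; left. Qed.

Lemma cops_winS J T (c : J -> X) x : cops_win T c x -> cops_win T.+1 c x.
Proof.
elim: T c x => [|T IH] c x /=; first by left.
case=> [?|[c' cc' w]]; first by left.
right; exists c' => //; case: w => [?|w]; first by left.
by right=> x' xx'; apply: IH; apply: w.
Qed.

Lemma cops_win_leq J T T' (c : J -> X) x :
  T <= T' -> cops_win T c x -> cops_win T' c x.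
Proof.
move=> le_TT' w; rewrite -(subnK le_TT').
by elim: (T' - T) => [|d IH] //; rewrite addSn; apply: cops_winS.
Qed.

Lemma cops_win_reindex J J' (f : J' -> J) T (c : J -> X) x :
  (forall j, exists j', f j' = j) -> cops_win T c x -> cops_win T (c \o f) x.
Proof.
move=> f_surj.
have caught_f (d : J -> X) y : caught d y -> caught (d \o f) y.
  by case=> j jy; have [j' fj'] := f_surj j; exists j'; rewrite /= fj'.
elim: T c x => [|T IH] c x /=; first exact: caught_f.
case=> [cx|[c' cc' w]]; first by left; apply: caught_f.
right; exists (c' \o f) => [j|]; first exact: cc'.
case: w => [c'x|w]; first by left; apply: caught_f.
by right=> x' xx'; apply: IH; apply: w.
Qed.

End PositionalGame.

(** The cops carry their moves from [X] to [Y] along [R] and read the robber's moves back. This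
    serves to ignore coordinates, to embed a factor and to pass to [cart_prod]. *)
Lemma cops_win_simulation X (mv eqv : X -> X -> Prop) Y (mv' eqv' : Y -> Y -> Prop)
    (R : X -> Y -> Prop) J T (c : J -> X) x (d : J -> Y) y :
    (forall x y u v, R x y -> R u v -> eqv x u -> eqv' y v) ->
    (forall x y x', R x y -> mv x x' -> exists2 y', mv' y y' & R x' y') ->
    (forall x y y', R x y -> mv' y y' -> exists2 x', mv x x' & R x' y') ->
  (forall j, R (c j) (d j)) -> R x y ->
  cops_win mv eqv T c x -> cops_win mv' eqv' T d y.
Proof.
move=> R_eqv R_forth R_back.
have R_caught c1 x1 d1 y1 : (forall j, R (c1 j) (d1 j)) -> R x1 y1 ->
    caught eqv c1 x1 -> caught eqv' d1 y1.
  by move=> Rcd Rxy [j ?]; exists j; apply: R_eqv (Rcd j) Rxy _.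
elim: T c x d y => [|T IH] c x d y Rcd Rxy /=; first exact: R_caught.
case=> [?|[c' cc' w]]; first by left; apply: R_caught Rcd Rxy _.
have [d' dd'] : {d' : J -> Y & forall j, mv' (d j) (d' j) /\ R (c' j) (d' j)}.
  apply: (@choice _ _ (fun j z => mv' (d j) z /\ R (c' j) z)) => j.
  by have [z] := R_forth _ _ _ (Rcd j) (cc' j); exists z.
have Rcd' j : R (c' j) (d' j) by case: (dd' j).
right; exists d' => [j|]; first by case: (dd' j).
case: w => [?|w]; first by left; apply: R_caught Rcd' Rxy _.
right=> y' yy'; have [x' xx' Rx'y'] := R_back _ _ _ Rxy yy'.
by apply: IH Rcd' Rx'y' _; apply: w.
Qed.

Definition wins (G : graph) (J : Type) (T : nat) : Prop :=
  exists c : J -> G, forall x, cops_win (@adj G) eq T c x.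

Lemma wins_leq (G : graph) J T T' : T <= T' -> wins G J T -> wins G J T'.
Proof. by move=> le_TT' [c w]; exists c => x; apply: cops_win_leq (w x). Qed.

Lemma wins_reindex (G : graph) J J' (f : J' -> J) T :
  (forall j, exists j', f j' = j) -> wins G J T -> wins G J' T.
Proof. by move=> f_surj [c w]; exists (c \o f) => x; apply: cops_win_reindex. Qed.

(** * Strategies on histories against strategies on positions *)

Section Evasion.
Variables (G : graph) (k : nat) (s : strategy G k) (x0 : G).
Variables (alive : nat -> Prop) (safe : nat -> ('I_k -> G) -> G -> Prop).
Hypothesis aliveW : forall t, alive t.+1 -> alive t.
Hypothesis safe_free : forall t c x, alive t -> safe t c x -> ~ caught eq c x.
Hypothesis safe_step : forall t c x c', alive t.+1 -> safe t c x ->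
  (forall j, adj (c j) (c' j)) ->
  ~ caught eq c' x /\ exists2 x', adj x x' & safe t.+1 c' x'.

(** The cops being deterministic, choosing an answer to each history and iterating gives one fixed
    walk, along which [safe] is invariant as long as [alive] holds. *)
Lemma evading_walk : legal s -> safe 0 (s [::]) x0 ->
  exists2 r, robber_walk r & forall t, alive t -> ~ captured_in_round s r t.
Proof.
move=> s_legal safe0.
have [f fP] : {f : seq G -> G & forall h, adj (last x0 h) (f h) /\
    ((exists2 y, adj (last x0 h) y & safe (size h) (s h) y) ->
     safe (size h) (s h) (f h))}.
  apply: (@choice _ _ (fun h y => adj (last x0 h) y /\
    ((exists2 y, adj (last x0 h) y & safe (size h) (s h) y) ->
     safe (size h) (s h) y))) => h.
  have [[y ? ?]|no] := pselect (exists2 y, adj (last x0 h) y & safe (size h) (s h) y).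
    by exists y.
  (* Without a safe answer the robber passes, so that the walk never stops. *)
  by exists (last x0 h); split=> //; apply: adj_refl.
pose hist t := iter t (fun h => rcons h (f h)) [:: x0].
pose r t := last x0 (hist t).
have size_hist t : size (hist t) = t.+1.
  by elim: t => //= t IH; rewrite size_rcons IH.
have rS t : r t.+1 = f (hist t) by rewrite /r /= last_rcons.
have histE t : mkseq r t.+1 = hist t.
  elim: t => [|t IH] //.
  have -> : mkseq r t.+2 = rcons (mkseq r t.+1) (r t.+1).
    by rewrite /mkseq -addn1 iotaD map_cat cats1.
  by rewrite IH rS.
have r_walk : robber_walk r by move=> t; rewrite rS; case: (fP (hist t)).
have safe_r t : alive t -> safe t (cops_at s r t) (r t).
  elim: t => [|t IH] al; first exact: safe0.
  have [_ ex] := safe_step al (IH (aliveW al)) (s_legal r r_walk t).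
  rewrite /cops_at histE in ex *; rewrite rS.
  by have [_] := fP (hist t); rewrite size_hist; apply.
exists r => // t al [j [[t_gt0 cj]|cj]].
  case: t t_gt0 al cj => // t _ al cj.
  have [nc _] := safe_step al (safe_r t (aliveW al)) (s_legal r r_walk t).
  by apply: nc; exists j.
by apply: (safe_free al (safe_r t al)); exists j.
Qed.

End Evasion.

(** Otherwise, from some [x0], the robber can keep the position not won for the cops in the [T - t]
    rounds left, and escapes through round [T]. *)
Lemma winning_within_wins (G : graph) k T (s : strategy G k) :
  winning_within T s -> wins G 'I_k T.
Proof.
case=> s_legal sT; exists (s [::]) => x0; apply: contrapT => nw.
have [] := @evading_walk G k s x0 (fun t => t <= T)
  (fun t c x => ~ cops_win (@adj G) eq (T - t) c x) _ _ _ s_legal.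
- by move=> t /ltnW.
- by move=> t c x _ ns ?; apply: ns; apply: caught_cops_win.
- move=> t c x c' lt_tT; rewrite -(subnSK lt_tT) /= => nw' cc'; split=> [?|].
    by apply: nw'; right; exists c' => //; left.
  apply: contrapT => no; apply: nw'; right; exists c' => //; right=> x' xx'.
  by apply: contrapT => nwx'; apply: no; exists x'.
- by rewrite subn0.
by move=> r /sT[t le_tT cap] esc; apply: (esc t).
Qed.

Lemma finite_bound (F : finType) (P : F -> nat -> Prop) :
  (forall x T T', T <= T' -> P x T -> P x T') ->
  (forall x, exists T, P x T) -> exists T, forall x, P x T.
Proof.
move=> P_mono /(@choice _ _ P)[f fP]; exists (\max_x f x) => x.
exact: P_mono (leq_bigmax x) (fP x).
Qed.

(* Koenig's lemma: a robber with finitely many moves who is caught by every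
   walk is caught within a uniform bound. *)
Lemma winning_wins (G : graph) k (s : strategy G k) :
  winning s -> exists T, wins G 'I_k T.
Proof.
case=> s_legal s_win.
suff [T w] : exists T, forall x, cops_win (@adj G) eq T (s [::]) x.
  by exists T, (s [::]).
apply: finite_bound => [x T T'|x0]; first exact: cops_win_leq.
apply: contrapT => nw.
have [] := @evading_walk G k s x0 (fun=> True)
  (fun t c x => ~ exists T, cops_win (@adj G) eq T c x) _ _ _ s_legal.
- by [].
- by move=> t c x _ ns ?; apply: ns; exists 0.
- move=> t c x c' _ nw' cc'; split=> [?|].
    by apply: nw'; exists 1; right; exists c' => //; left.
  apply: contrapT => no; apply: nw'.
  have [T wT] : exists T, forall x', adj x x' -> cops_win (@adj G) eq T c' x'.
    apply: finite_bound => [x' T T' le_TT' w /w|x']; first exact: cops_win_leq.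
    have [[T w]|nwx'] := pselect (exists T, cops_win (@adj G) eq T c' x').
      by exists T.
    (* An [x'] without a bound is no neighbour of [x], or it would be a safe answer; 0 is then
       vacuously a bound. *)
    by exists 0 => xx'; case: no; exists x'.
  by exists T.+1; right; exists c' => //; right.
- by [].
by move=> r /s_win[t cap] esc; apply: (esc t).
Qed.

(** A positional answer is folded along the history, together with a counter of the rounds left. *)
Lemma wins_winning_within (G : graph) k T :
  wins G 'I_k T -> exists s : strategy G k, winning_within T s.
Proof.
case=> c0 w0.
pose good (p : nat * {ffun 'I_k -> G} * G) (c' : {ffun 'I_k -> G}) :=
  let: (t, c, x) := p in (forall j, adj (c j) (c' j)) /\
  (cops_win (@adj G) eq t.+1 c x -> ~ caught eq c x ->
   caught eq c' x \/ forall x', adj x x' -> cops_win (@adj G) eq t c' x').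
have [f fP] : {f & forall p, good p (f p)}.
  apply: choice => -[[t c] x] /=.
  have [[c' cc' w]|no] := pselect (exists2 c' : 'I_k -> G,
    (forall j, adj (c j) (c' j)) &
    caught eq c' x \/ forall x', adj x x' -> cops_win (@adj G) eq t c' x').
    exists (finfun c').
    have -> : (finfun c' : 'I_k -> G) = c' by apply/funext => j; rewrite ffunE.
    by [].
  (* Where there is no winning answer the cops pass, which keeps the strategy legal. *)
  by exists c; split=> [j|[]//]; first exact: adj_refl.
pose play := foldl (fun p x => (p.1.-1, f (p.1.-1, p.2, x))) (T, finfun c0).
pose s h := (play h).2.
have play1 h : (play h).1 = T - size h.
  elim/last_ind: h => [|h x IH]; first by rewrite subn0.
  by rewrite /play foldl_rcons /= -/(play h) IH size_rcons -subnS.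
have sS r t : cops_at s r t.+1 = f ((T - t).-1, cops_at s r t, r t).
  rewrite /cops_at /s.
  have -> : mkseq r t.+1 = rcons (mkseq r t) (r t).
    by rewrite /mkseq -addn1 iotaD map_cat cats1.
  by rewrite /play foldl_rcons /= -/(play _) play1 size_mkseq.
exists s; split=> [r _ t j|r r_walk].
  by rewrite sS; case: (fP ((T - t).-1, cops_at s r t, r t)).
apply: contrapT => nocap.
have free t : t <= T -> ~ captured_in_round s r t.
  by move=> ? ?; apply: nocap; exists t.
have inv t : t <= T -> cops_win (@adj G) eq (T - t) (cops_at s r t) (r t).
  elim: t => [_|t IH lt_tT].
    rewrite subn0 /cops_at /s /=.
    have -> : (finfun c0 : 'I_k -> G) = c0 by apply/funext => j; rewrite ffunE.
    exact: w0.
  have [_] := fP ((T - t).-1, cops_at s r t, r t); rewrite -sS.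
  have -> : (T - t).-1 = T - t.+1 by rewrite subnS.
  case.
  - by rewrite (subnSK lt_tT); apply/IH/ltnW.
  - by case=> j cj; apply: (free t (ltnW lt_tT)); exists j; right.
  - by case=> j cj; case: (free t.+1 lt_tT); exists j; left.
  - by apply; apply: r_walk.
have := inv T (leqnn T); rewrite subnn => -[j cj].
by apply: (free T (leqnn T)); exists j; right.
Qed.

(** * Distances and the radius *)

Section Distance.
Variable G : graph.
Hypothesis G_conn : connected G.

Lemma dist_path (u v : G) :
  exists p, [/\ path (@adj G) u p, last u p = v & size p = dist u v].
Proof.
have [_ /(_ u v)/connectP[p up vE]] := G_conn.
by have [] := @leastP (fun d => exists p : seq G,
  [/\ path (@adj G) u p, last u p = v & size p = d]); first by exists (size p), p.
Qed.

Lemma dist_leq (u : G) p : path (@adj G) u p -> dist u (last u p) <= size p.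
Proof.
move=> up; have [|_] := @leastP (fun d => exists q : seq G,
    [/\ path (@adj G) u q, last u q = last u p & size q = d]).
  by exists (size p), p.
by apply; exists p.
Qed.

Lemma dist_eq0 (u v : G) : dist u v = 0 -> u = v.
Proof. by have [[|w p] [_ /= <- <-]] := dist_path u v. Qed.

Lemma distxx (u : G) : dist u u = 0.
Proof. by apply/eqP; rewrite -leqn0; apply: (@dist_leq u [::]). Qed.

Lemma dist_closer (u v : G) :
  0 < dist u v -> exists2 u', adj u u' & dist u' v < dist u v.
Proof.
have [[|u' p] [/= + <- <-]] := dist_path u v; first by [].
by case/andP=> uu' u'p _; exists u' => //; apply: dist_leq.
Qed.

(** The cop takes the first step of a shortest path, and the robber's step is appended at its end;
    if [u = v] the cop copies the robber's step. *)
Lemma dist_follow (u v v' : G) :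
  adj v v' -> exists2 u', adj u u' & dist u' v' <= dist u v.
Proof.
have [[|u' p] [/= + <- <-]] := dist_path u v.
  by move=> _ vv'; exists v' => //; apply: (@dist_leq v' [::]).
case/andP=> uu' u'p vv'; exists u' => //.
have := @dist_leq u' (rcons p v'); rewrite last_rcons size_rcons; apply.
by rewrite rcons_path u'p.
Qed.

Lemma centerP : exists z : G, forall v, dist z v <= radius G.
Proof.
have [G_gt0 _] := G_conn; have [u _] := card_gt0P G_gt0.
have [|[z zE] _] := @leastP (fun d => exists u : G, eccentricity u = d).
  by exists (eccentricity u), u.
by exists z => v; rewrite /radius -zE; apply: leq_bigmax.
Qed.

Lemma radius_gt0 : 1 < #|G| -> 0 < radius G.
Proof.
have [z zP] := centerP; rewrite !ltnNge; apply: contra; rewrite leqn0 => /eqP r0.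
have zE v : z = v by apply: dist_eq0; apply/eqP; rewrite -leqn0 -r0.
by apply/fintype_le1P => x y; rewrite -(zE x) -(zE y).
Qed.

End Distance.

Lemma sum_setU (I : finType) (U V : {set I}) (F : I -> nat) : [disjoint U & V] ->
  \sum_(i in U :|: V) F i = \sum_(i in U) F i + \sum_(i in V) F i.
Proof.
by move=> dUV; rewrite -bigU //; apply: eq_bigl => i; rewrite !inE.
Qed.

(** * The game on a subset of the factors *)

Section Product.
Variables (n : nat) (G : 'I_n -> graph).
Hypothesis G_conn : forall i, connected (G i).

Notation X := {dffun forall i : 'I_n, G i}.
Implicit Types (S U V : {set 'I_n}) (x y z : X) (i : 'I_n) (T a b d m : nat).

Definition agree S x y : Prop := forall i, i \in S -> x i = y i.

(* [step S] and [agree S] play the product of the factors in [S], leaving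
   the other coordinates of the players unconstrained. *)
Definition step S x y : Prop :=
  exists2 i, i \in S & adj (x i) (y i) /\
    forall j, j \in S -> j != i -> x j = y j.

Definition merge S x y : X := finfun (fun i => if i \in S then x i else y i).

Definition put x i (u : G i) : X := finfun (dfwith x u).

(** The distance in the Cartesian product of the factors in [S]. *)
Definition sdist S x y : nat := \sum_(i in S) dist (x i) (y i).

Notation win S := (@cops_win X (step S) (agree S)).

Lemma put_in x i (u : G i) : put x u i = u.
Proof. by rewrite ffunE dfwith_in. Qed.

Lemma put_out x i (u : G i) j : j != i -> put x u j = x j.
Proof. by move=> ji; rewrite ffunE dfwith_out // eq_sym. Qed.

Lemma merge_in S x y : agree S (merge S x y) x.
Proof. by move=> i iS; rewrite ffunE iS. Qed.

Lemma merge_out S U x y : [disjoint S & U] -> agree U y (merge S x y).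
Proof. by move=> dSU i iU; rewrite ffunE (disjointFl dSU iU). Qed.

Lemma agree_sym S x y : agree S x y -> agree S y x.
Proof. by move=> xy i /xy. Qed.

Lemma agree_trans S x y z : agree S x y -> agree S y z -> agree S x z.
Proof. by move=> xy yz i iS; rewrite xy ?yz. Qed.

Lemma agreeU U V x y : agree U x y -> agree V x y -> agree (U :|: V) x y.
Proof. by move=> xyU xyV i; rewrite inE => /orP[/xyU|/xyV]. Qed.

(** A pass uses the loop of some factor in [S]; for empty [S] there is no [step] at all, whence the
    membership hypotheses below. *)
Lemma step_refl i S x : i \in S -> step S x x.
Proof. by exists i => //; split=> //; apply: adj_refl. Qed.

Lemma step_put i S x (u : G i) : i \in S -> adj (x i) u -> step S x (put x u).
Proof.
by exists i => //; split=> [|j _ ji]; rewrite ?put_in // put_out.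
Qed.

Lemma agree_put i S x (u : G i) : i \notin S -> agree S x (put x u).
Proof. by move=> iS j jS; rewrite put_out //; apply: contraNneq iS => <-. Qed.

Lemma agree_step S x y z : agree S x y -> step S y z -> step S x z.
Proof.
move=> xy [i iS [yzi yz]]; exists i => //; rewrite xy //; split=> // j jS ji.
by rewrite xy // yz.
Qed.

Lemma step_agree S x y z : step S x y -> agree S y z -> step S x z.
Proof.
move=> [i iS [xyi xy]] yz; exists i => //; rewrite -yz //; split=> // j jS ji.
by rewrite -yz // xy.
Qed.

Lemma stepU U V x y : step U x y -> agree V x y -> step (U :|: V) x y.
Proof.
move=> [i iU [xyi xyU]] xyV; exists i; first by rewrite inE iU.
by split=> // j; rewrite inE => /orP[/xyU|/xyV].
Qed.

(** A robber move, even a pass, is charged to the half containing the index that witnesses it. *)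
Lemma stepU_case U V x y : [disjoint U & V] -> step (U :|: V) x y ->
  step U x y /\ agree V x y \/ step V x y /\ agree U x y.
Proof.
move=> dUV [i + [xyi xy]]; rewrite inE => /orP[iU|iV]; [left|right].
- split; first by exists i => //; split=> // j jU; apply: xy; rewrite inE jU.
  move=> j jV; apply: xy; first by rewrite inE jV orbT.
  by apply: contraTneq jV => ->; rewrite (disjointFr dUV iU).
- split; first by exists i => //; split=> // j jV; apply: xy; rewrite inE jV orbT.
  move=> j jU; apply: xy; first by rewrite inE jU.
  by apply: contraTneq jU => ->; rewrite (disjointFl dUV iV).
Qed.

Lemma eq_sdist S x x' y y' :
  agree S x x' -> agree S y y' -> sdist S x y = sdist S x' y'.
Proof. by move=> xx' yy'; apply: eq_bigr => i iS; rewrite xx' ?yy'. Qed.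

Lemma sdistxx S x : sdist S x x = 0.
Proof. by apply: big1 => i _; apply: distxx. Qed.

Lemma sdist_eq0 S x y : sdist S x y <= 0 -> agree S x y.
Proof.
rewrite leqn0 sum_nat_eq0 => /forall_inP d0 i iS.
by apply: dist_eq0 => //; apply/eqP/d0.
Qed.

Lemma sdistD1 S x y i :
  i \in S -> sdist S x y = dist (x i) (y i) + sdist (S :\ i) x y.
Proof.
move=> iS; rewrite /sdist (bigD1 i) //=; congr (_ + _).
by apply: eq_bigl => j; rewrite !inE andbC.
Qed.

Lemma sdist_closer S x y i d : i \in S -> sdist S x y <= d.+1 ->
  exists x', [/\ step S x x', agree (~: S) x x' & sdist S x' y <= d].
Proof.
move=> i0S le_d; case: (posnP (sdist S x y)) => [d0|].
  exists x; split; [exact: step_refl i0S|by []|by rewrite d0].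
rewrite lt0n sum_nat_eq0 negb_forall => /existsP[j].
rewrite negb_imply -lt0n => /andP[jS /(dist_closer (G_conn j))[u xu lt_u]].
exists (put x u); split; first exact: step_put.
  by apply: agree_put; rewrite inE negbK.
rewrite -ltnS; apply: leq_trans le_d.
rewrite !(sdistD1 _ _ jS) put_in -addSn leq_add //.
  rewrite (@eq_sdist _ _ x _ y) //; apply: agree_sym; apply: agree_put; rewrite !inE eqxx //.
Qed.

Lemma sdist_follow S x y y' : step S y y' ->
  exists x', [/\ step S x x', agree (~: S) x x' & sdist S x' y' <= sdist S x y].
Proof.
move=> [i iS [yy'i yy']].
have [u xu le_u] := dist_follow (G_conn i) (x i) yy'i.
exists (put x u); split; first exact: step_put.
  by apply: agree_put; rewrite inE negbK.
rewrite !(sdistD1 _ _ iS) put_in leq_add // (@eq_sdist _ _ x _ y) //.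
  by apply: agree_sym; apply: agree_put; rewrite !inE eqxx.
by move=> j; rewrite !inE => /andP[ji jS]; rewrite yy'.
Qed.

Lemma win_agree S (J : Type) T (c c' : J -> X) x x' :
  (forall j, agree S (c j) (c' j)) -> agree S x x' -> win S T c x -> win S T c' x'.
Proof.
move=> cc' xx'; apply: (cops_win_simulation (R := agree S)) => //.
- move=> u v u1 v1 uv uv1 uu1.
  by apply: agree_trans (agree_sym uv) (agree_trans uu1 uv1).
- by move=> u v u' uv uu'; exists u' => //; apply: agree_step (agree_sym uv) uu'.
- by move=> u v v' uv vv'; exists v' => //; apply: agree_step uv vv'.
Qed.

Lemma win_factor i (J : Type) T (c : J -> G i) (C : J -> X) y :
  (forall j, C j i = c j) -> cops_win (@adj (G i)) eq T c (y i) -> win [set i] T C y.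
Proof.
move=> Cc; apply: (cops_win_simulation (R := fun u x => x i = u)) => //.
- by move=> x z u v xz uv xu j /set1P->; rewrite xz uv.
- move=> u x u' <- xu; exists (put x u'); last by rewrite put_in.
  by apply: step_put => //; rewrite set11.
- by move=> u x x' <- [j /set1P-> [xx' _]]; exists (x' i).
Qed.

Lemma win_product (J : Type) T (c : J -> X) y : 0 < n ->
  win [set: 'I_n] T c y -> cops_win (@adj (cart_prod G)) eq T c y.
Proof.
move=> n_gt0.
have stepE x z : step setT x z <-> @adj (cart_prod G) x z.
  split=> [[i _ [xzi xz]]|/= /orP[/eqP->|/existsP[i /andP[xzi /forallP xz]]]].
  - apply/orP; right; apply/existsP; exists i; rewrite xzi.
    by apply/forallP => j; apply/implyP => ji; rewrite xz ?inE.
  (* The disjunct [x == y] of [prod_adj] is a pass, which is a [step] because [n > 0]. *)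
  - exact: (step_refl _ (in_setT (Ordinal n_gt0))).
  - by exists i => //; split=> // j _ ji; apply/eqP/(implyP (xz j)).
apply: (cops_win_simulation (R := fun x z : X => x = z)) => //.
- by move=> x _ u _ <- <- xu; apply/ffunP => i; apply: xu; rewrite inE.
- by move=> x _ x' <- xx'; exists x' => //; apply/stepE.
- by move=> x _ x' <- xx'; exists x' => //; apply/stepE.
Qed.

Lemma agree_sub S S' x y : S \subset S' -> agree S' x y -> agree S x y.
Proof. by move=> /subsetP sub xy i /sub/xy. Qed.

Lemma merge_step U V x y : [disjoint U & V] ->
  step U x y -> step (U :|: V) x (merge U y x).
Proof.
move=> dUV xy; apply: stepU; last exact: merge_out.
by apply: step_agree xy (agree_sym _); apply: merge_in.
Qed.

(* A team of cops that plays the [U]-game on the robber's moves in [U], after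
   having brought each of its cops onto the robber's [V]-coordinates; [a] bounds
   how many robber moves in [U] or passes it still needs. *)
Definition ready U V a (J : Type) (c : J -> X) x : Prop :=
  exists d T, [/\ d + T <= a, forall j, sdist V (c j) x <= d
    & forall y, 0 < d \/ step U x y -> win U T c y].

(** * The moves of one team *)

Section Team.
Variables (U V : {set 'I_n}) (iU iV : 'I_n) (J : Type).
Hypotheses (UiU : iU \in U) (ViV : iV \in V) (dUV : [disjoint U & V]).
Implicit Type c : J -> X.

Let sUV : U \subset ~: V.
Proof. by rewrite -disjoints_subset. Qed.

Lemma ready_caught c x : ready U V 0 c x -> caught (agree (U :|: V)) c x.
Proof.
move=> [[|d] [[|T] [// _ dV /(_ x)[]]]].
  (* Both [d] and [T] are 0 here, and a pass is the robber move in [U] that [ready] asks for. *)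
  by right; apply: step_refl UiU.
by move=> j cj; exists j; apply: agreeU cj _; apply: sdist_eq0.
Qed.

(** Nothing changes on [U], and following the robber on [V] does not increase the distances there,
    so the budget [a] is kept. *)
Lemma ready_follow a c x x' : ready U V a c x -> step V x x' -> agree U x x' ->
  exists2 c', (forall j, step (U :|: V) (c j) (c' j)) & ready U V a c' x'.
Proof.
move=> [d [T [le_a dV wU]]] xx' xx'U.
have [c' c'P] := choice (fun j => sdist_follow (c j) xx').
have cc'U j : agree U (c j) (c' j) by case: (c'P j) => _ + _; apply: agree_sub.
exists c' => [j|].
  by rewrite setUC; apply: stepU (cc'U j); case: (c'P j).
exists d, T; split=> // [j|y y_ok].
  by case: (c'P j) => _ _ /leq_trans; apply; apply: dV.
apply: (win_agree cc'U (x := y)) => //; apply: wU.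
by case: y_ok; [left|right; apply: agree_step xx'U _].
Qed.

(** If [d > 0], each cop uses the move to approach on [V], the [U]-game being still won from every
    robber position. If [d = 0], the team plays a winning move on [U]. Either way one unit of the
    budget is spent. *)
Lemma ready_advance a c x x' : ready U V a.+1 c x -> step U x x' -> agree V x x' ->
  caught (agree (U :|: V)) c x' \/
  exists2 c', (forall j, step (U :|: V) (c j) (c' j)) &
    caught (agree (U :|: V)) c' x' \/ ready U V a c' x'.
Proof.
move=> [[|d] [T [le_a dV wU]]] xx' xx'V; last first.
  right; have dV' j : sdist V (c j) x' <= d.+1.
    by rewrite -(@eq_sdist V (c j) (c j) x x').
  have [c' c'P] := choice (fun j => sdist_closer ViV (dV' j)).
  have cc'U j : agree U (c j) (c' j) by case: (c'P j) => _ + _; apply: agree_sub.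
  exists c' => [j|].
    by rewrite setUC; apply: stepU (cc'U j); case: (c'P j).
  right; exists d, T; split=> // [j|y _]; first by case: (c'P j).
  by apply: (win_agree cc'U (x := y)) => //; apply: wU; left.
have cV j : agree V (c j) x' by apply: agree_trans (sdist_eq0 (dV j)) xx'V.
have capU (c' : J -> X) : (forall j, agree V (c' j) x') ->
    caught (agree U) c' x' -> caught (agree (U :|: V)) c' x'.
  by move=> c'V [j cj]; exists j; apply: agreeU.
(* With [T = 0] a cop already meets the robber at [x'], before the cops move. *)
case: T wU le_a => [|T] /(_ x' (or_intror xx')) /=; first by left; apply: capU.
case=> [?|[c' cc' w]] le_a; first by left; apply: capU.
right; pose c1 j := merge U (c' j) (c j).
have c'c1 j : agree U (c' j) (c1 j) by apply/agree_sym/merge_in.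
have c1V j : agree V (c1 j) x'.
  by apply: agree_trans (cV j); apply/agree_sym/merge_out.
exists c1 => [j|]; first exact: merge_step.
case: w => [[j cj]|w].
  left; apply: capU => //; exists j.
  by apply: agree_trans cj; apply/agree_sym/c'c1.
right; exists 0, T; split=> // [j|y [//|x'y]].
  by rewrite (eq_sdist (c1V j) (y' := x')) // sdistxx.
by apply: (win_agree c'c1 (x := y)) => //; apply: w.
Qed.

End Team.

(** * Two teams playing together *)

Definition join (J1 J2 : Type) (c1 : J1 -> X) (c2 : J2 -> X) (j : J1 + J2) : X :=
  match j with inl j1 => c1 j1 | inr j2 => c2 j2 end.

Lemma caught_joinl S (J1 J2 : Type) (c1 : J1 -> X) (c2 : J2 -> X) x :
  caught (agree S) c1 x -> caught (agree S) (join c1 c2) x.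
Proof. by case=> j cj; exists (inl j). Qed.

Lemma caught_joinr S (J1 J2 : Type) (c1 : J1 -> X) (c2 : J2 -> X) x :
  caught (agree S) c2 x -> caught (agree S) (join c1 c2) x.
Proof. by case=> j cj; exists (inr j). Qed.

(** Each robber move lowers [a] or [b] by one, and the first to reach 0 means capture. The other is
    then still positive, so [a + b - 1] rounds suffice. *)
Lemma ready_ready_win U V iU iV (J1 J2 : Type) m a b (c1 : J1 -> X) (c2 : J2 -> X) x :
    iU \in U -> iV \in V -> [disjoint U & V] -> a + b <= m.+1 ->
    ready U V a c1 x -> ready V U b c2 x ->
  caught (agree (U :|: V)) (join c1 c2) x \/
  forall x', step (U :|: V) x x' -> win (U :|: V) m (join c1 c2) x'.
Proof.
move=> UiU ViV dUV; have dVU : [disjoint V & U] by rewrite disjoint_sym.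
elim: m a b c1 c2 x => [|m IH] [|a] [|b] c1 c2 x le_ab r1 r2.
all: try by [left; apply: caught_joinl; exact: (ready_caught UiU r1)].
all: try by [left; apply: caught_joinr; rewrite setUC; exact: (ready_caught ViV r2)].
  by rewrite addnS in le_ab.
right=> x' /(stepU_case dUV)[[xx'U xx'V]|[xx'V xx'U]].
- have [cx'|[c1' cc1' w1]] := ready_advance ViV dUV r1 xx'U xx'V.
    by left; apply: caught_joinl.
  have [c2' cc2' r2'] := ready_follow dVU r2 xx'U xx'V.
  right; exists (join c1' c2') => [[j|j]|] /=; first exact: cc1'.
    by rewrite setUC; apply: cc2'.
  case: w1 => [c1x|r1']; first by left; apply: caught_joinl.
  by apply: IH r1' r2'.
- have [cx'|[c2' cc2' w2]] := ready_advance UiU dVU r2 xx'V xx'U.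
    by left; apply: caught_joinr; rewrite setUC.
  have [c1' cc1' r1'] := ready_follow dUV r1 xx'V xx'U.
  right; exists (join c1' c2') => [[j|j]|] /=; first exact: cc1'.
    by rewrite setUC; apply: cc2'.
  case: w2 => [c2x|r2']; first by left; apply: caught_joinr; rewrite setUC.
  by apply: IH r1' r2'; rewrite addnS in le_ab.
Qed.

Definition wins_in S (J : Type) T : Prop := exists c : J -> X, forall x, win S T c x.

Definition rad_sum S : nat := \sum_(i in S) radius (G i).

Lemma rad_sumU U V : [disjoint U & V] ->
  rad_sum (U :|: V) = rad_sum U + rad_sum V.
Proof. exact: sum_setU. Qed.

Lemma product_centerP : exists z, forall S x, sdist S z x <= rad_sum S.
Proof.
pose z : X := finfun (fun i => projT1 (cid (centerP (G_conn i)))).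
exists z => S x; apply: leq_sum => i _.
by rewrite ffunE; case: (cid _) => u /=; apply.
Qed.

Lemma wins_in_setU U V iU iV (J1 J2 : Type) T1 T2 :
    iU \in U -> iV \in V -> [disjoint U & V] ->
    wins_in U J1 T1 -> wins_in V J2 T2 ->
  wins_in (U :|: V) (J1 + J2) (rad_sum (U :|: V) + T1 + T2).-1.
Proof.
move=> UiU ViV dUV [c1 w1] [c2 w2]; have [z zP] := product_centerP.
have dVU : [disjoint V & U] by rewrite disjoint_sym.
have readyP U' V' J T (c : J -> X) x : [disjoint U' & V'] -> (forall y, win U' T c y) ->
    ready U' V' (rad_sum V' + T) (fun j => merge U' (c j) z) x.
  (* The team starts at a centre on [V'] and at its winning placement on [U']. *)
  move=> dUV' w; exists (rad_sum V'), T; split=> // [j|y _].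
    by rewrite -(@eq_sdist V' z _ x x) //; apply: merge_out.
  by apply: (win_agree (c := c) (x := y)) => // j; apply/agree_sym/merge_in.
exists (join (fun j => merge U (c1 j) z) (fun j => merge V (c2 j) z)) => x.
have := @ready_ready_win U V iU iV _ _ (rad_sum (U :|: V) + T1 + T2).-1 _ _ _ _ x
  UiU ViV dUV _ (readyP _ _ _ _ _ _ dUV w1) (readyP _ _ _ _ _ _ dVU w2).
case=> [|?|]; [rewrite rad_sumU //; lia|exact: caught_cops_win|apply].
(* The cops move first, so the robber's placement is treated as followed by a pass. *)
by apply: (step_refl (i := iU)); rewrite inE UiU.
Qed.

(** * Repeated halving of the set of factors *)

Section Logarithm.
Variables k t : 'I_n -> nat.
Hypothesis wins_t : forall i, wins (G i) 'I_(k i) (t i).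
Hypothesis t_pos : forall i, 0 < radius (G i) + t i.

(* [#|S|] is moved to the right-hand side: this is
   [rad_sum S * m + \sum_(i in S) (t i - 1) + 1 <= N] without truncation. *)
Lemma wins_in_log S m N : 0 < #|S| <= 2 ^ m ->
    rad_sum S * m + \sum_(i in S) t i + 1 <= N + #|S| ->
  wins_in S 'I_(\sum_(i in S) k i) N.
Proof.
have [z _] := product_centerP.
have t_sum S' : #|S'| <= rad_sum S' + \sum_(i in S') t i.
  by rewrite -sum1_card /rad_sum -big_split; apply: leq_sum.
elim: m S N => [|m IH] S N.
  rewrite -eqn_leq eq_sym => /cards1P[i ->]; rewrite muln0 cards1 leq_add2r !big_set1.
  have [c w] := wins_t i; move=> le_N; exists (fun j => put z (c j)) => x.
  by apply: cops_win_leq le_N (win_factor _ (w _)) => j; rewrite put_in.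
move=> /andP[S_gt0 le_S] le_N; have [le_S'|lt_S] := leqP #|S| (2 ^ m).
  by apply: IH; [rewrite S_gt0|apply: leq_trans le_N; rewrite mulnS; lia].
(* [U] takes exactly [2 ^ m] factors, which leaves between 1 and [2 ^ m] for [V]. *)
pose U := [set i in take (2 ^ m) (enum S)]; pose V := S :\: U.
have US : U \subset S.
  by apply/subsetP => i; rewrite inE => /mem_take; rewrite mem_enum.
have cardU : #|U| = 2 ^ m.
  rewrite cardsE (card_uniqP _) ?take_uniq ?enum_uniq // size_takel //.
  by rewrite -cardE ltnW.
have defS : U :|: V = S by rewrite -[RHS](setID S U) (setIidPr US).
have dUV : [disjoint U & V] by rewrite -setI_eq0 /V setIDA (setIidPl US) setDv.
have cardS : #|S| = #|U| + #|V| by rewrite cardsD (setIidPr US) subnKC ?subset_leq_card.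
have V_gt0 : 0 < #|V| by lia.
have U_gt0 : 0 < #|U| by rewrite cardU expn_gt0.
have le_V : #|V| <= 2 ^ m by move: le_S; rewrite expnS; lia.
have [[iU UiU] [iV ViV]] := (card_gt0P U_gt0, card_gt0P V_gt0).
have wins_half S' : 0 < #|S'| <= 2 ^ m ->
    wins_in S' 'I_(\sum_(i in S') k i)
      (rad_sum S' * m + \sum_(i in S') t i + 1 - #|S'|).
  by move=> S'P; apply: IH => //; lia.
(* This makes the subtraction in [wins_half] exact; for [m > 0] it rests on [t_pos], for [m = 0] on
   [#|S'| <= 1]. *)
have m_sum S' : 0 < #|S'| <= 2 ^ m -> #|S'| <= rad_sum S' * m + \sum_(i in S') t i + 1.
  have := t_sum S'; case: (m) => [|m']; first by lia.
  by rewrite mulnS; lia.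
have wU : 0 < #|U| <= 2 ^ m by rewrite U_gt0 cardU leqnn.
have wV : 0 < #|V| <= 2 ^ m by rewrite V_gt0 le_V.
have [c w] := wins_in_setU UiU ViV dUV (wins_half _ wU) (wins_half _ wV).
rewrite -defS sum_setU //.
exists (c \o @split _ _) => x.
have w' := cops_win_reindex (f := @split _ _)
  (fun j => ex_intro _ (unsplit j) (unsplitK j)) (w x).
apply: cops_win_leq w'.
(* The two terms [+ 1] of the halves and the predecessor in [wins_in_setU] leave a single [+ 1], and
   the new [rad_sum S] raises [m] to [m.+1]. *)
have := m_sum _ wU; have := m_sum _ wV; move: le_N.
rewrite cardS -defS rad_sumU // sum_setU // mulnDl !mulnS; lia.
Qed.

(** The times [t] are kept general because the two bounds of the theorem need different choices. *)
Lemma product_winning_within N : 0 < n ->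
    (\sum_(i < n) radius (G i)) * up_log 2 n + \sum_(i < n) t i + 1 <= N + n ->
  exists s : strategy (cart_prod G) (\sum_(i < n) k i), winning_within N s.
Proof.
have sumT F : \sum_(i in [set: 'I_n]) F i = \sum_(i < n) F i.
  by apply: eq_bigl => i; rewrite inE.
move=> n_gt0 le_N.
have [||c w] := @wins_in_log setT (up_log 2 n) N.
- by rewrite cardsT card_ord n_gt0 up_logP.
- by rewrite /rad_sum !sumT cardsT card_ord.
apply: wins_winning_within; rewrite -sumT; exists c => x.
exact: win_product.
Qed.

End Logarithm.
End Product.

(** * Cop numbers, capture times and the final bound *)

Lemma winning_within_winning (G : graph) k T (s : strategy G k) :
  winning_within T s -> winning s.
Proof. by case=> ? sT; split=> // r /sT[t _ ?]; exists t. Qed.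

(** The minimum exists because one cop on every vertex wins in round 0. *)
Lemma cop_numberP (G : graph) : exists s : strategy G (cop_number G), winning s.
Proof.
have [|//] := @leastP (fun k => exists s : strategy G k, winning s).
exists #|G|.
suff /wins_winning_within[s /winning_within_winning] : wins G 'I_#|G| 0 by exists s.
by exists enum_val => x; exists (enum_rank x); rewrite enum_rankK.
Qed.

Lemma capt_wins (G : graph) k : connected G -> cop_number G <= k ->
  wins G 'I_k (capt k G).
Proof.
move=> [G_gt0 _] le_k; have [u _] := card_gt0P G_gt0.
have [s s_win] := cop_numberP G.
have c_gt0 : 0 < cop_number G.
  case: (s_win) => _ /(_ (fun=> u) (fun=> adj_refl u))[t [j _]].
  by apply: leq_ltn_trans (ltn_ord j).
have [T wT] := winning_wins s_win.
have wk : wins G 'I_k T.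
  (* The surplus cops duplicate cop 0. *)
  apply: (wins_reindex (f := fun j : 'I_k => insubd (Ordinal c_gt0) (val j))) wT.
  move=> j; exists (widen_ord le_k j); apply: val_inj.
  by rewrite val_insubd /= ltn_ord.
have [|[s' s'T] _] := @leastP (fun T => exists s : strategy G k, winning_within T s).
  by exists T; apply: wins_winning_within.
exact: winning_within_wins s'T.
Qed.

Local Open Scope ring_scope.

(* The first conjunct says that the left-hand side of the bound is well defined.
   A one-vertex graph has capture time 0, so its term capt - 1 is -1 and the
   bound read in the integers fails, e.g. for two one-vertex graphs (0 <= -1).
   It is therefore stated in the integers for graphs with at least two vertices,
   and for arbitrary graphs with the truncated predecessor of capt. *)
Theorem theorem2p4 (n : nat) (G : 'I_n -> graph) (k : 'I_n -> nat)
    (n_gt0 : (0 < n)%N)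
    (G_connected : forall i, connected (G i))
    (k_ge : forall i, (cop_number (G i) <= k i)%N) :
  let K := (\sum_(i < n) k i)%N in
  [/\ (cop_number (cart_prod G) <= K)%N,
      (forall i, (1 < #|G i|)%N) ->
      (capt K (cart_prod G))%:Z <=
        (\sum_(i < n) (radius (G i))%:Z) * (up_log 2 n)%:Z
        + \sum_(i < n) ((capt (k i) (G i))%:Z - 1) + 1
    & (capt K (cart_prod G) <=
        (\sum_(i < n) radius (G i)) * up_log 2 n
        + \sum_(i < n) (capt (k i) (G i)).-1 + 1)%N].
Proof.
move=> K.
have wins_capt i := capt_wins (G_connected i) (k_ge i).
have capt_le N : (exists s : strategy (cart_prod G) K, winning_within N s) ->
    (capt K (cart_prod G) <= N)%N.
  move=> exN; have [|_] := @leastP (fun T =>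
    exists s : strategy (cart_prod G) K, winning_within T s).
    by exists N.
  exact.
have [s s_win] : exists s : strategy (cart_prod G) K, winning_within
    ((\sum_(i < n) radius (G i)) * up_log 2 n
        + \sum_(i < n) (capt (k i) (G i)).-1 + 1)%N s.
  (* A capture time 0 is raised to 1, so that [t_pos] holds whatever the radius. *)
  apply: (@product_winning_within n G G_connected k
    (fun i => (capt (k i) (G i)).-1.+1)) => // [i|i|].
  - by apply: wins_leq (wins_capt i); apply: leqSpred.
  - by rewrite addnS.
  - have -> : (\sum_(i < n) (capt (k i) (G i)).-1.+1 =
        \sum_(i < n) (capt (k i) (G i)).-1 + n)%N.
      under eq_bigr do rewrite -addn1.
      by rewrite big_split /= sum1_card card_ord.
    by rewrite addnA [leqRHS]addnAC.
split=> [|G_gt1|]; last by apply: capt_le; exists s.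
  have [|_] := @leastP (fun k => exists s : strategy (cart_prod G) k, winning s).
    by exists K, s; apply: winning_within_winning s_win.
  by apply; exists s; apply: winning_within_winning s_win.
(* Positive radii give [t_pos] with the exact capture times, even if some are 0. *)
have rad_gt0 i := radius_gt0 (G_connected i) (G_gt1 i).
set R := (\sum_(i < n) radius (G i))%N.
set C := (\sum_(i < n) capt (k i) (G i))%N.
have n_le_R : (n <= R)%N.
  by rewrite -[leqLHS]card_ord -sum1_card; apply: leq_sum.
(* Subtracting [n] is thus exact: for [n > 1] the logarithm is positive and [n <= R], and for
   [n = 1] the final [+ 1] is enough. *)
have n_le : (n <= R * up_log 2 n + C + 1)%N.
  case: (ltngtP n 1) n_gt0 => [|n_gt1|->] // _; last by rewrite addn1.
  have : (0 < up_log 2 n)%N by rewrite up_log_gt0.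
  by case: (up_log 2 n) => // m _; rewrite mulnS; lia.
have : (capt K (cart_prod G) <= R * up_log 2 n + C + 1 - n)%N.
  apply: capt_le; apply: (product_winning_within G_connected wins_capt) => //.
    by move=> i; rewrite addn_gt0 rad_gt0.
  by rewrite subnK.
have -> : \sum_(i < n) (radius (G i))%:Z = R%:Z.
  by rewrite /R (big_morph Posz PoszD (erefl 0%:Z)).
have -> : \sum_(i < n) ((capt (k i) (G i))%:Z - 1) = C%:Z - n%:Z.
  by rewrite sumrB sumr_const card_ord natz /C (big_morph Posz PoszD (erefl 0%:Z)).
rewrite -PoszM; lia.
Qed.
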